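(* Let $F=\frac1n\sum_{i=1}^n f_i:\mathbb{R}^d\to\mathbb{R}$, where $F$ is differentiable and $\mu$-strongly convex ($\mu>0$), and each $f_i:\mathbb{R}^d\to\mathbb{R}$ is differentiable, convex and $L$-smooth. Let $x^*$ be the unique minimizer of $F$, let $\zeta:=\min\{L/n,\mu\}$ and $\sigma_*^2:=\frac{1}{n^2}\left(\sum_{i=1}^n\|\nabla f_i(x^* )\|_2\right)^2$. Let $(x_k,(g_k^i)_{i=1}^n)_{k\ge 0}$ be generated by the SRG algorithm (described in the context) with step sizes and lower bounds $$\alpha_k:=\frac{2(k+k_0)+1}{[c+(k+k_0)(k+k_0+2)]\,\zeta},\qquad \varepsilon_k:=\frac{20L\alpha_k}{n},$$ where $k_0:=\frac{80L}{\zeta}-2$ and $c:=\frac{40L}{\zeta}$. (The standing requirements that, for all $k\in\mathbb{N}$, $\alpha_k/\varepsilon_k$ is constant, $\varepsilon_k\in(0,1/(2n)]$, and $\alpha_k\le n\varepsilon_k/(20L)$ are satisfied by these choices.) Define, with $a=0.673$, $$T^k:=\frac{\alpha_k}{n\varepsilon_k}\frac{a}{L}\sum_{i=1}^n\|g_k^i-\nabla f_i(x^* )\|_2^2+\|x_k-x^*\|_2^2 .$$ Then $$\mathbb{E}[T^k]\le O\!\left(\frac{T^0+\sigma_*^2\log k}{k^2}\right)+O\!\left(\frac{\sigma_*^2}{k}\right).$$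
   Context: $[n]=\{1,\dots,n\}$. $\mu$-strongly convex: $F(y)\ge F(x)+\langle\nabla F(x),y-x\rangle+\frac{\mu}{2}\|y-x\|_2^2$ for all $x,y\in\mathbb{R}^d$. $L$-smooth: $\|\nabla f_i(y)-\nabla f_i(x)\|_2\le L\|y-x\|_2$ for all $x,y\in\mathbb{R}^d$. The $O(\cdot)$ is the usual asymptotic notation in the iteration number $k$. Let $\Delta$ be the probability simplex in $\mathbb{R}^n$ and, for $\varepsilon\in(0,1/n]$, $\Delta(\varepsilon)=\{p\in\Delta: p^i\ge\varepsilon\ \forall i\in[n]\}$. SRG algorithm: parameters are step sizes $\alpha_k>0$ and lower bounds $\varepsilon_k\in(0,1/n]$; the initialization is $x_0\in\mathbb{R}^d$ and $g_0^1,\dots,g_0^n\in\mathbb{R}^d$. For $k=0,1,2,\dots$: 1. $p_k=\arg\min_{p\in\Delta(\varepsilon_k)}\frac{1}{n^2}\sum_{i=1}^n\frac{1}{p^i}\|g_k^i\|_2^2$ (any minimizer if it is not unique); 2. sample an index $i_k\in[n]$ from the distribution $p_k$; 3. $x_{k+1}=x_k-\alpha_k\frac{1}{np_k^{i_k}}\nabla f_{i_k}(x_k)$; 4. sample $b_k\sim\mathrm{Bernoulli}(\varepsilon_k/p_k^{i_k})$; 5. $g_{k+1}^i=\nabla f_i(x_k)$ if $i=i_k$ and $b_k=1$; $g_{k+1}^i=g_k^i$ otherwise. The expectation is over the random draws $(i_t,b_t)$ of the algorithm. *)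

(* Defs.v *)
From HB Require Import structures.
From mathcomp Require Import all_boot all_order all_algebra.
From mathcomp Require Import all_classical all_reals all_analysis.

Set Implicit Arguments.
Unset Strict Implicit.
Unset Printing Implicit Defensive.

Import Order.TTheory GRing.Theory Num.Theory.
Import numFieldNormedType.Exports.

Local Open Scope classical_set_scope.
Local Open Scope ring_scope.

Section Euclidean.
Context {R : realType} {d : nat}.
Implicit Types (f : 'rV[R]_d -> R) (x y u v : 'rV[R]_d).

Definition dotp u v : R := \sum_(j < d) u 0 j * v 0 j.

(* The library norm on 'rV[R]_d is the sup norm; it is used below only through
   [differentiable], which does not depend on the choice of the norm. *)
Definition norm2 u : R := Num.sqrt (dotp u u).

Definition grad f x : 'rV[R]_d := \row_(j < d) 'D_(delta_mx 0 j) f x.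

Definition strongly_convex (mu : R) f : Prop :=
  forall x y,
    f x + dotp (grad f x) (y - x) + mu / 2 * norm2 (y - x) ^+ 2 <= f y.

Definition smooth (L : R) f : Prop :=
  forall x y, norm2 (grad f y - grad f x) <= L * norm2 (y - x).

End Euclidean.

Definition is_argmin {R : realType} {E : Type} (D : set E) (phi : E -> R)
    (z : E) : Prop :=
  D z /\ forall z', D z' -> phi z <= phi z'.

Definition average {R : realType} {n d : nat} (f : 'I_n -> 'rV[R]_d -> R)
    (x : 'rV[R]_d) : R :=
  n%:R^-1 * \sum_(i < n) f i x.

Definition simplex {R : realType} {n : nat} : set 'rV[R]_n :=
  [set p | (forall i, 0 <= p 0 i) /\ \sum_(i < n) p 0 i = 1].

Definition trunc_simplex {R : realType} {n : nat} (eps : R) : set 'rV[R]_n :=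
  [set p | simplex p /\ forall i, eps <= p 0 i].

Definition sampling_obj {R : realType} {n d : nat} (g : 'I_n -> 'rV[R]_d)
    (p : 'rV[R]_n) : R :=
  (n%:R ^+ 2)^-1 * \sum_(i < n) (p 0 i)^-1 * norm2 (g i) ^+ 2.

Section SRG.
Context {R : realType} {n d : nat} {dsp : measure_display}
  {Omega : measurableType dsp}.
Implicit Types (I : nat -> Omega -> 'I_n) (B : nat -> Omega -> bool).

(* The event "the draws (I_t, B_t), t < k, take the values they have at w".
   There are finitely many values, so conditioning on these events is the same
   as conditioning on the sigma-algebra generated by the first k draws. *)
Definition same_past I B (k : nat) (w : Omega) : set Omega :=
  [set w' | forall t, (t < k)%N -> I t w' = I t w /\ B t w' = B t w].

Record SRG_run (alpha eps : nat -> R) (f : 'I_n -> 'rV[R]_d -> R)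
    (x0 : 'rV[R]_d) (g0 : 'I_n -> 'rV[R]_d) (P : probability Omega R)
    (x : nat -> Omega -> 'rV[R]_d) (g : nat -> Omega -> 'I_n -> 'rV[R]_d)
    (p : nat -> Omega -> 'rV[R]_n) I B : Prop := {
  SRG_measurable_I : forall k i, measurable [set w | I k w = i] ;
  SRG_measurable_B : forall k c, measurable [set w | B k w = c] ;
  SRG_x0 : forall w, x 0%N w = x0 ;
  SRG_g0 : forall w i, g 0%N w i = g0 i ;
  SRG_p_argmin : forall k w,
    is_argmin (trunc_simplex (eps k)) (sampling_obj (g k w)) (p k w) ;
  (* ties between minimizers are broken using only the previous draws *)
  SRG_p_past : forall k w w', same_past I B k w w' -> p k w' = p k w ;
  SRG_I_law : forall k w i,
    P (same_past I B k w `&` [set w' | I k w' = i])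
    = (P (same_past I B k w) * (p k w 0 i)%:E)%E ;
  SRG_x_step : forall k w,
    x k.+1 w = x k w
      - (alpha k * (n%:R * p k w 0 (I k w))^-1) *: grad (f (I k w)) (x k w) ;
  SRG_B_law : forall k w i c,
    P (same_past I B k w `&` [set w' | I k w' = i] `&` [set w' | B k w' = c])
    = (P (same_past I B k w `&` [set w' | I k w' = i])
       * (bernoulli_pmf (eps k / p k w 0 i) c)%:E)%E ;
  SRG_g_step : forall k w i,
    g k.+1 w i =
      if (i == I k w) && B k w then grad (f i) (x k w) else g k w i
}.

End SRG.

Section Schedule.
Context {R : realType} (n : nat) (L mu : R).

Definition zeta : R := Num.min (L / n%:R) mu.

Definition k_shift : R := 80 * L / zeta - 2.

Definition c_shift : R := 40 * L / zeta.

Definition step_size (k : nat) : R :=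
  let m := k%:R + k_shift in
  (2 * m + 1) / ((c_shift + m * (m + 2)) * zeta).

Definition lower_bound (k : nat) : R := 20 * L * step_size k / n%:R.

End Schedule.

Definition sigma2 {R : realType} {n d : nat} (f : 'I_n -> 'rV[R]_d -> R)
    (xs : 'rV[R]_d) : R :=
  (n%:R ^+ 2)^-1 * (\sum_(i < n) norm2 (grad (f i) xs)) ^+ 2.

Definition lyapunov {R : realType} {n d : nat} (L alpha eps : R)
    (f : 'I_n -> 'rV[R]_d -> R) (xs : 'rV[R]_d)
    (x : 'rV[R]_d) (g : 'I_n -> 'rV[R]_d) : R :=
  alpha / (n%:R * eps) * (673 / 1000 / L)
    * (\sum_(i < n) norm2 (g i - grad (f i) xs) ^+ 2)
  + norm2 (x - xs) ^+ 2.

(* Main.v *)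
Require Import Defs.
From HB Require Import structures.
From mathcomp Require Import all_boot all_order all_algebra.
From mathcomp Require Import all_classical all_reals all_analysis.
From mathcomp Require Import measurable_realfun ring lra.

Import Order.TTheory GRing.Theory Num.Theory.
Import numFieldNormedType.Exports.

Local Open Scope classical_set_scope.
Local Open Scope ring_scope.

(** The ratio [alpha_k / (n eps_k) = 1 / (20 L)] does not depend on [k], so [T^k]
is one fixed Lyapunov function [V].  Conditionally on the past, the table part
of [V] relaxes at rate [eps_k] towards the gradients at [x_k], whose distance to
the gradients at [xs] is at most [2 L n (F(x_k) - F(xs))] by cocoercivity,
while the distance part loses [2 alpha_k (F(x_k) - F(xs)) + alpha_k mu |x_k - xs|^2]
and gains the second moment of the step.  Splitting each gradient through
[g^i] and [grad f_i xs], and using that [p_k] is nearly optimal for the table,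
this second moment is absorbed up to [12 alpha_k^2 sigma^2]:
[E_k V_{k+1} <= (1 - alpha_k zeta) V_k + 12 alpha_k^2 sigma^2].
With [W_k = c + (k + k_0)^2 - 1] one has [W_{k+1} (1 - alpha_k zeta) = W_k] and
[W_{k+1} alpha_k^2 <= 4 / zeta^2], so [W_k E V_k] grows at most linearly, while
[W_k >= k^2].

Only finitely many values of the first [k] draws are possible, so all
expectations are finite sums over histories. *)

Set Implicit Arguments.
Unset Strict Implicit.

(** * Euclidean inner product and norm on row vectors *)

Section InnerProduct.
Context {R : realType} {d : nat}.
Implicit Types (u v w : 'rV[R]_d).

Lemma dotpC u v : dotp u v = dotp v u.
Proof. by apply: eq_bigr => j _; rewrite mulrC. Qed.

Lemma dotpDl u v w : dotp (u + v) w = dotp u w + dotp v w.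
Proof. by rewrite -big_split; apply: eq_bigr => j _; rewrite mxE mulrDl. Qed.

Lemma dotpZl (a : R) u v : dotp (a *: u) v = a * dotp u v.
Proof. by rewrite /dotp mulr_sumr; apply: eq_bigr => j _; rewrite mxE mulrA. Qed.

Lemma dotpNl u v : dotp (- u) v = - dotp u v.
Proof. by rewrite -scaleN1r dotpZl mulN1r. Qed.

Lemma dotpBl u v w : dotp (u - v) w = dotp u w - dotp v w.
Proof. by rewrite dotpDl dotpNl. Qed.

Lemma dotpDr u v w : dotp w (u + v) = dotp w u + dotp w v.
Proof. by rewrite dotpC dotpDl !(dotpC w). Qed.

Lemma dotpZr (a : R) u v : dotp v (a *: u) = a * dotp v u.
Proof. by rewrite dotpC dotpZl dotpC. Qed.

Lemma dotpNr u v : dotp v (- u) = - dotp v u.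
Proof. by rewrite dotpC dotpNl dotpC. Qed.

Lemma dotpBr u v w : dotp w (u - v) = dotp w u - dotp w v.
Proof. by rewrite dotpDr dotpNr. Qed.

Lemma dotp0l u : dotp 0 u = 0.
Proof. by rewrite -(scale0r 0) dotpZl mul0r. Qed.

Lemma dotp_suml (n : nat) (F : 'I_n -> 'rV[R]_d) v :
  dotp (\sum_i F i) v = \sum_i dotp (F i) v.
Proof.
apply: (big_morph (fun u => dotp u v)); last exact: dotp0l.
by move=> ? ?; rewrite dotpDl.
Qed.

Lemma dotpp_ge0 u : 0 <= dotp u u.
Proof. by apply: sumr_ge0 => j _; rewrite -expr2 sqr_ge0. Qed.

Lemma dotpp_eq0 u : dotp u u = 0 -> u = 0.
Proof.
move/psumr_eq0P => H; apply/rowP => j; rewrite mxE.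
have /eqP := H (fun j _ => sqr_ge0 (u 0 j)) j isT.
by rewrite -expr2 sqrf_eq0 => /eqP.
Qed.

Lemma norm2_ge0 u : 0 <= norm2 u.
Proof. exact: sqrtr_ge0. Qed.

Lemma sqr_norm2 u : norm2 u ^+ 2 = dotp u u.
Proof. by rewrite sqr_sqrtr // dotpp_ge0. Qed.

Lemma norm2Z (a : R) u : norm2 (a *: u) = `|a| * norm2 u.
Proof.
by rewrite /norm2 dotpZl dotpZr mulrA -expr2 sqrtrM ?sqr_ge0 // sqrtr_sqr.
Qed.

(** Cauchy-Schwarz: the squared norm of [norm2 v *: u - norm2 u *: v] is twice [norm2 u * norm2 v]
    times the gap, and that product is positive for nonzero vectors. *)
Lemma dotp_le_norm2 u v : dotp u v <= norm2 u * norm2 v.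
Proof.
have [->|u0] := eqVneq u 0.
  by rewrite dotp0l mulr_ge0 // norm2_ge0.
have [->|v0] := eqVneq v 0.
  by rewrite dotpC dotp0l mulr_ge0 // norm2_ge0.
have pos w : w != 0 -> 0 < norm2 w.
  move=> w0; rewrite sqrtr_gt0 lt_def dotpp_ge0 andbT.
  by apply: contra_neq w0 => /dotpp_eq0.
have := dotpp_ge0 (norm2 v *: u - norm2 u *: v).
rewrite !(dotpBl, dotpBr, dotpZl, dotpZr) (dotpC v u) -!sqr_norm2.
have a0 := pos _ u0; have b0 := pos _ v0.
have ab0 : 0 < norm2 u * norm2 v by rewrite mulr_gt0.
move=> H; rewrite -subr_ge0 -(pmulr_rge0 _ ab0); nra.
Qed.

Lemma norm2_triangle u v : norm2 (u + v) <= norm2 u + norm2 v.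
Proof.
rewrite -(@ler_pXn2r _ 2) ?nnegrE ?addr_ge0 ?norm2_ge0 //.
rewrite sqrrD !sqr_norm2 dotpDl !dotpDr (dotpC v u).
have := dotp_le_norm2 u v; lra.
Qed.

(** The gap is the sum of the three squared pairwise distances. *)
Lemma sqr_norm2D3 u v w :
  norm2 (u + v + w) ^+ 2
    <= 3 * (norm2 u ^+ 2 + norm2 v ^+ 2 + norm2 w ^+ 2).
Proof.
rewrite !sqr_norm2.
have := dotpp_ge0 (u - v); have := dotpp_ge0 (u - w); have := dotpp_ge0 (v - w).
rewrite !(dotpBl, dotpBr, dotpDl, dotpDr) (dotpC v u) (dotpC w u) (dotpC w v).
lra.
Qed.

End InnerProduct.

(** * Quadratic bounds, tangents and cocoercivity for smooth convex functions *)

Section Smoothness.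
Context {R : realType} {d : nat}.
Implicit Types (f : 'rV[R]_d -> R) (x y v : 'rV[R]_d).

Lemma derive_dotp_grad f x v :
  differentiable f x -> 'D_v f x = dotp (grad f x) v.
Proof.
move=> df; rewrite deriveE // {1}(row_sum_delta v) linear_sum /=.
by apply: eq_bigr => j _; rewrite linearZ /= mxE deriveE // mulrC.
Qed.

Lemma is_derive_along f x v (t : R) :
  differentiable f (x + t *: v) ->
  is_derive t 1 (fun s : R => f (x + s *: v)) (dotp (grad f (x + t *: v)) v).
Proof.
move=> df; rewrite -derive_dotp_grad //.
have E : (fun h : R => h^-1 *: (((fun s : R => f (x + s *: v)) \o shift t) (h *: 1)
      - f (x + t *: v)))
    = (fun h : R => h^-1 *: ((f \o shift (x + t *: v)) (h *: v)
      - f (x + t *: v))).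
  apply/funext => h /=; congr (_ *: (f _ - _)).
  by rewrite [h *: 1]mulr1 scalerDl addrCA.
have dv := @diff_derivable _ _ _ _ _ v df.
apply: DeriveDef; first by rewrite /derivable E.
by rewrite /derive E.
Qed.

(** The sign [s] yields the upper ([s = 1]) and the lower ([s = -1]) quadratic bound from one mean
    value argument. *)
Lemma smooth_quadratic_bound (L : R) f x v (s : R) : `|s| = 1 ->
  (forall y, differentiable f y) -> smooth L f ->
  s * (f (x + v) - f x - dotp (grad f x) v) <= L / 2 * norm2 v ^+ 2.
Proof.
move=> s1 df sm.
(* [psi 1 - psi 0] is the left side of the goal minus the right side, so a nonpositive derivative on
   the unit interval suffices. *)
pose psi (t : R) := s * (f (x + t *: v) - dotp (grad f x) v * t)
   - (L / 2 * norm2 v ^+ 2) * t ^+ 2.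
pose dpsi (t : R) := s * (dotp (grad f (x + t *: v)) v - dotp (grad f x) v)
   - (L * norm2 v ^+ 2) * t.
have H (t : R) : is_derive t 1 psi (dpsi t).
  have ? := is_derive_along (df (x + t *: v)).
  rewrite /psi; apply: is_derive_eq.
  rewrite /dpsi /GRing.scale /=. lra.
have [|c] := @MVT_segment R psi dpsi 0 1 ler01 (fun t _ => H t).
  by apply: derivable_within_continuous => t _; have [] := H t.
rewrite in_itv /= => /andP[c0 c1].
rewrite subr0 mulr1 /psi scale1r scale0r addr0 mulr1 mulr0 expr1n expr0n /= => E.
suff : dpsi c <= 0 by move: E; lra.
rewrite /dpsi -dotpBl -dotpZl subr_le0.
apply: le_trans (dotp_le_norm2 _ _) _; rewrite norm2Z s1 mul1r.
apply: le_trans (ler_wpM2r (norm2_ge0 _) (sm _ _)) _.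
by rewrite (addrC x) addrK norm2Z (ger0_norm c0); lra.
Qed.

Lemma smooth_upper_bound (L : R) f x y :
  (forall z, differentiable f z) -> smooth L f ->
  f y <= f x + dotp (grad f x) (y - x) + L / 2 * norm2 (y - x) ^+ 2.
Proof.
move=> df sm; have := @smooth_quadratic_bound L f x (y - x) 1 (normr1 _) df sm.
by rewrite (addrC x) subrK; lra.
Qed.

Lemma convex_along f (t : R) x y :
  convex_function (setT : set (convex_lmodType 'rV[R]_d)) f ->
  0 <= t -> t <= 1 ->
  f (x + t *: (y - x)) <= t * f y + (1 - t) * f x.
Proof.
move=> cf t0 t1.
have := cf (Itv01 t0 t1) y x (in_setT _) (in_setT _).
rewrite convRE /= /unstable.onem => cvx; apply: le_trans cvx.
suff -> : x + t *: (y - x) = conv (Itv01 t0 t1)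
    (y : convex_lmodType 'rV[R]_d) (x : convex_lmodType 'rV[R]_d) by [].
rewrite /conv /= scalerBr addrCA; congr (_ + _).
by rewrite /unstable.onem scalerBl scale1r.
Qed.

Lemma convex_above_tangent (L : R) f x y : 0 < L ->
  (forall z, differentiable f z) -> smooth L f ->
  convex_function (setT : set (convex_lmodType 'rV[R]_d)) f ->
  f x + dotp (grad f x) (y - x) <= f y.
Proof.
move=> L0 df sm cf; set v := y - x.
rewrite leNgt; apply/negP => lt_f.
set D := f x + dotp (grad f x) v - f y.
have D0 : 0 < D by rewrite subr_gt0.
set N := norm2 v ^+ 2.
have N0 : 0 <= N by rewrite sqr_ge0.
(* At [x + t *: v] convexity and the lower quadratic bound force [D <= t * (L * N) / 2]. This choice
   of [t] lies in [(0, 1]] and gives [t * (L * N) = D - t * D < D], a contradiction. *)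
pose t := D / (D + L * N).
have LN : 0 <= L * N by rewrite mulr_ge0 // ltW.
have DLN : 0 < D + L * N by rewrite ltr_wpDr.
have t0 : 0 < t by rewrite divr_gt0.
have t1 : t <= 1 by rewrite ler_pdivrMr // mul1r lerDl.
have tE : t * (L * N) = D - t * D by rewrite /t; field; rewrite gt_eqF.
have cvx := convex_along x y cf (ltW t0) t1; rewrite -/v in cvx.
have := @smooth_quadratic_bound L f x (t *: v) (-1) (normrN1 _) df sm.
rewrite dotpZr norm2Z (gtr0_norm t0) exprMn -/N.
move=> low.
have tD : 0 < t * D by rewrite mulr_gt0.
have ttD : 0 < t * (t * D) by rewrite mulr_gt0.
have ttE : t * (t * (L * N)) = t * (D - t * D) by rewrite tE.
have tDE : t * D = t * f x + t * dotp (grad f x) v - t * f y.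
  by rewrite /D mulrBr mulrDr.
clearbody D N t; lra.
Qed.

(* Compare the tangent at x with the quadratic upper bound at y, both evaluated
   at the minimiser y - w / L of their difference. *)
Lemma convex_smooth_bregman (L : R) f x y : 0 < L ->
  (forall z, differentiable f z) -> smooth L f ->
  convex_function (setT : set (convex_lmodType 'rV[R]_d)) f ->
  norm2 (grad f y - grad f x) ^+ 2
    <= 2 * L * (f y - f x - dotp (grad f x) (y - x)).
Proof.
move=> L0 df sm cf; set w := grad f y - grad f x.
have := @convex_above_tangent L f x (y - L^-1 *: w) L0 df sm cf.
have := @smooth_upper_bound L f y (y - L^-1 *: w) df sm.
have -> : y - L^-1 *: w - y = - (L^-1 *: w) by rewrite addrC addKr.
have -> : y - L^-1 *: w - x = (y - x) - L^-1 *: w by rewrite addrAC.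
rewrite dotpNr dotpZr (dotpBr (y - x)) dotpZr -scaleNr norm2Z normrN.
rewrite gtr0_norm ?invr_gt0 //.
have E : norm2 w ^+ 2 = dotp (grad f y) w - dotp (grad f x) w.
  by rewrite sqr_norm2 -dotpBl.
rewrite exprMn => A B.
have C : norm2 w ^+ 2 / (2 * L) <= f y - f x - dotp (grad f x) (y - x).
  have LE : L / 2 * (L^-1 ^+ 2 * norm2 w ^+ 2) = norm2 w ^+ 2 / (2 * L).
    by field; rewrite gt_eqF.
  have LE2 : L^-1 * dotp (grad f y) w - L^-1 * dotp (grad f x) w
      = 2 * (norm2 w ^+ 2 / (2 * L)).
    by rewrite -mulrBr -E; field; rewrite gt_eqF.
  rewrite LE in A; lra.
by rewrite ler_pdivrMr ?mulr_gt0 // mulrC in C.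
Qed.

End Smoothness.

(** * The averaged objective and its minimiser *)

Section Average.
Context {R : realType} {n d : nat}.
Variables (L : R) (f : 'I_n -> 'rV[R]_d -> R).
Hypotheses (n_gt0 : (0 < n)%N) (L_gt0 : 0 < L).
Hypothesis df : forall i x, differentiable (f i) x.
Hypothesis smooth_f : forall i, smooth L (f i).

Let nR_gt0 : 0 < n%:R :> R. Proof. by rewrite ltr0n. Qed.
Let nR_neq0 : n%:R != 0 :> R. Proof. by rewrite gt_eqF. Qed.

Lemma average_sum x : \sum_i f i x = n%:R * average f x.
Proof. by rewrite /average mulrA divff // mul1r. Qed.

Lemma grad_average x : grad (average f) x = n%:R^-1 *: \sum_i grad (f i) x.
Proof.
have E : average f = n%:R^-1 \*: \sum_i f i.
  by apply/funext => y; rewrite /average /= fct_sumE.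
apply/rowP => j; rewrite !mxE summxE E deriveZ; last first.
  by apply: derivable_sum => i; exact: diff_derivable.
rewrite derive_sum; last by move=> i; exact: diff_derivable.
by congr (_ * _); apply: eq_bigr => i _; rewrite mxE.
Qed.

Lemma dotp_grad_average x v :
  \sum_i dotp (grad (f i) x) v = n%:R * dotp (grad (average f) x) v.
Proof. by rewrite grad_average dotpZl dotp_suml mulrA divff // mul1r. Qed.

Lemma average_smooth_upper_bound x y :
  average f y <= average f x + dotp (grad (average f) x) (y - x)
                 + L / 2 * norm2 (y - x) ^+ 2.
Proof.
rewrite -(ler_pM2l nR_gt0) !mulrDr -!average_sum -dotp_grad_average -big_split /=.
set q := L / 2 * _; have -> : n%:R * q = \sum_(i < n) q.
  by rewrite sumr_const card_ord mulr_natl.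
rewrite -big_split /=.
by apply: ler_sum => i _; exact: smooth_upper_bound.
Qed.

(** A gradient step of size [1 / L] from [xs] lowers the average by at least [dotp G G / (2 * L)],
    so minimality forces [G = 0]. *)
Lemma grad_average_argmin xs :
  is_argmin setT (average f) xs -> grad (average f) xs = 0.
Proof.
move=> [_ min_xs]; set G := grad _ _; apply: dotpp_eq0.
have := min_xs (xs - L^-1 *: G) I.
have := average_smooth_upper_bound xs (xs - L^-1 *: G).
have -> : xs - L^-1 *: G - xs = - (L^-1 *: G) by rewrite addrC addKr.
rewrite -/G -[- (_ *: G)]scaleNr dotpZr norm2Z exprMn sqr_norm2.
rewrite normrN gtr0_norm ?invr_gt0 // => up low.
have E : L / 2 * (L^-1 ^+ 2 * dotp G G) = L^-1 * dotp G G / 2.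
  by field; rewrite gt_eqF.
rewrite E in up.
apply/eqP; rewrite eq_le dotpp_ge0 andbT -(pmulr_rle0 (x := L^-1)) ?invr_gt0 //.
lra.
Qed.

(** Summed cocoercivity at [xs]; the linear terms add up to a multiple of the vanishing gradient of
    the average. *)
Lemma sum_grad_diff_le xs x :
  (forall i, convex_function (setT : set (convex_lmodType 'rV[R]_d)) (f i)) ->
  is_argmin setT (average f) xs ->
  \sum_i norm2 (grad (f i) x - grad (f i) xs) ^+ 2
    <= 2 * L * n%:R * (average f x - average f xs).
Proof.
move=> cf min_xs.
apply: le_trans (ler_sum _ (fun i _ =>
  @convex_smooth_bregman _ _ L (f i) xs x L_gt0 (@df i) (@smooth_f i) (@cf i))) _.
rewrite -mulr_sumr !sumrB !average_sum dotp_grad_average.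
by rewrite grad_average_argmin // dotp0l mulr0 subr0 -mulrBr mulrA.
Qed.

End Average.

(** * Near-optimality of the sampling distribution, and finite sums *)

(* Comparing the minimiser with eps + (1 - n eps) |g_i| / sum |g_j| costs a
   factor 1 / (1 - n eps) <= 2 over unconstrained importance sampling. *)
Lemma argmin_sampling_obj_le (R : realType) (n d : nat) (eps : R)
    (g : 'I_n -> 'rV[R]_d) (p : 'rV[R]_n) :
  (0 < n)%N -> 0 < eps -> n%:R * eps <= 2^-1 ->
  is_argmin (trunc_simplex eps) (sampling_obj g) p ->
  \sum_i (p 0 i)^-1 * norm2 (g i) ^+ 2 <= 2 * (\sum_i norm2 (g i)) ^+ 2.
Proof.
move=> n0 e0 ne [_ min_p].
have n2 : 0 < (n%:R ^+ 2)^-1 :> R by rewrite invr_gt0 exprn_gt0 ?ltr0n.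
set G := \sum_i norm2 (g i).
have G0 : 0 <= G by apply: sumr_ge0 => i _; exact: norm2_ge0.
(* The trial distribution divides by [G]; if [G = 0], all norms vanish and so do both sides. *)
have [G_eq0|Gneq0] := eqVneq G 0.
  rewrite big1 ?mulr_ge0 ?sqr_ge0 // => i _.
  move/psumr_eq0P: G_eq0 => -> //; first by rewrite expr0n mulr0.
  by move=> j _; exact: norm2_ge0.
have Gpos : 0 < G by rewrite lt_def Gneq0.
pose q : 'rV[R]_n := \row_i (eps + (1 - n%:R * eps) * (norm2 (g i) / G)).
have q_ge i : eps <= q 0 i.
  rewrite mxE lerDl mulr_ge0 ?divr_ge0 ?norm2_ge0 // subr_ge0.
  by apply: le_trans ne _; lra.
have q_ge2 i : 2^-1 * (norm2 (g i) / G) <= q 0 i.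
  have h : 0 <= norm2 (g i) / G by rewrite divr_ge0 ?norm2_ge0.
  by rewrite mxE; nra.
have /min_p : trunc_simplex eps q.
  split=> //; split=> [i|]; first exact: le_trans (ltW e0) (q_ge i).
  under eq_bigr do rewrite mxE.
  rewrite big_split /= sumr_const card_ord -mulr_sumr -mulr_suml -/G divff //.
  by rewrite mulr1 -[eps *+ n]mulr_natl; ring.
rewrite ler_pM2l // => /le_trans; apply.
(* Expanding only one factor [G] of the square reduces the bound to the termwise [norm2 (g i) ^+ 2 /
   q 0 i <= 2 * G * norm2 (g i)]. *)
rewrite expr2 mulrA {2}/G mulr_sumr; apply: ler_sum => i _.
have qpos : 0 < q 0 i := lt_le_trans e0 (q_ge i).
rewrite mulrC ler_pdivrMr // expr2 (mulrC (2 * G)) -mulrA.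
apply: ler_wpM2l; first exact: norm2_ge0.
have := ler_wpM2l (mulr_ge0 (ler0n R 2) G0) (q_ge2 i).
by rewrite (_ : _ * G * _ = norm2 (g i)) //; field; rewrite Gneq0.
Qed.

(** Lagrange's identity: the gap is half the double sum of [(a i - a j) ^+ 2]. *)
Lemma sqr_sum_le (R : realType) (n : nat) (a : 'I_n -> R) :
  (\sum_i a i) ^+ 2 <= n%:R * \sum_i a i ^+ 2.
Proof.
have : 0 <= \sum_i \sum_j (a i - a j) ^+ 2.
  by apply: sumr_ge0 => i _; apply: sumr_ge0 => j _; exact: sqr_ge0.
suff -> : \sum_i \sum_j (a i - a j) ^+ 2
    = 2 * (n%:R * \sum_i a i ^+ 2 - (\sum_i a i) ^+ 2) by lra.
transitivity (\sum_(i < n) (n%:R * a i ^+ 2 + \sum_j a j ^+ 2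
    - 2 * (a i * \sum_j a j))).
  apply: eq_bigr => i _.
  have -> : n%:R * a i ^+ 2 = \sum_(j < n) a i ^+ 2.
    by rewrite sumr_const card_ord mulr_natl.
  rewrite !mulr_sumr -big_split -sumrB /=.
  by apply: eq_bigr => j _; ring.
rewrite sumrB big_split /= sumr_const card_ord -[(\sum_j _) *+ n]mulr_natl.
by rewrite -!mulr_sumr -mulr_suml expr2; ring.
Qed.

Lemma big_update1 (R : realType) (n : nat) (i : 'I_n) (a : R) (b : 'I_n -> R) :
  \sum_j (if j == i then a else b j) = \sum_j b j + a - b i.
Proof.
rewrite (bigD1 i) //= eqxx [in RHS](bigD1 i) //= (eq_bigr b).
  by ring.
by move=> j /negPf ->.
Qed.

(** * Conditional contraction of the Lyapunov function in one step *)

Section OneStep.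
Context {R : realType} {n d : nat}.
Variables (L mu z alpha : R) (f : 'I_n -> 'rV[R]_d -> R) (xs : 'rV[R]_d).
Hypotheses (n_gt0 : (0 < n)%N) (L_gt0 : 0 < L).
Hypotheses (z_le_L : z <= L / n%:R) (z_le_mu : z <= mu).
Hypotheses (alpha_gt0 : 0 < alpha) (alpha_le : 40 * L * alpha <= 1).
Hypothesis df : forall i x, differentiable (f i) x.
Hypothesis smooth_f : forall i, smooth L (f i).
Hypothesis convex_f :
  forall i, convex_function (setT : set (convex_lmodType 'rV[R]_d)) (f i).
Hypothesis convex_F : strongly_convex mu (average f).
Hypothesis min_xs : is_argmin setT (average f) xs.

Let eps : R := 20 * L * alpha / n%:R.
Let V := lyapunov L alpha eps f xs.

Variables (x : 'rV[R]_d) (g : 'I_n -> 'rV[R]_d) (p : 'rV[R]_n).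
Hypothesis min_p : is_argmin (trunc_simplex eps) (sampling_obj g) p.

Let gs i := grad (f i) xs.
Let Sg : R := \sum_i norm2 (g i - gs i) ^+ 2.
Let Sx : R := \sum_i norm2 (grad (f i) x - gs i) ^+ 2.
Let D : R := norm2 (x - xs) ^+ 2.
Let Q : R := \sum_i (p 0 i)^-1 * norm2 (grad (f i) x) ^+ 2.

Let nR_gt0 : 0 < n%:R :> R. Proof. by rewrite ltr0n. Qed.
Let nR_neq0 : n%:R != 0 :> R. Proof. by rewrite gt_eqF. Qed.
Let L_neq0 : L != 0. Proof. by rewrite gt_eqF. Qed.
Let alpha_neq0 : alpha != 0. Proof. by rewrite gt_eqF. Qed.
Let eps_gt0 : 0 < eps. Proof. by rewrite divr_gt0 // !mulr_gt0. Qed.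

Let p_ge i : eps <= p 0 i. Proof. by case: min_p => -[_ ->]. Qed.
Let p_gt0 i : 0 < p 0 i. Proof. exact: lt_le_trans (p_ge i). Qed.
Let p_sum : \sum_i p 0 i = 1. Proof. by case: min_p => -[[_ ->]]. Qed.

(** Since [alpha / (n%:R * eps) = 1 / (20 * L)], the step size cancels; this later identifies the
    Lyapunov functions of different iterations. *)
Lemma lyapunovE y h :
  V y h = 673 / 20000 / L ^+ 2 * \sum_i norm2 (h i - gs i) ^+ 2
          + norm2 (y - xs) ^+ 2.
Proof.
rewrite /V /lyapunov /eps; congr (_ * _ + _); field.
by rewrite alpha_neq0 nR_neq0 L_neq0.
Qed.

(** Each gradient is split as [(grad (f i) x - gs i) + (gs i - g i) + g i]. For the first two parts
    [1 / p] is at most [1 / eps]; the last is controlled by near-optimality of [p], then compared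
    with [gs] by the triangle inequality. *)
Lemma sampling_second_moment :
  Q <= 3 * ((Sx + Sg) / eps + 4 * n%:R ^+ 2 * sigma2 f xs + 4 * n%:R * Sg).
Proof.
pose G := \sum_i (p 0 i)^-1 * norm2 (g i) ^+ 2.
have Q_le : Q <= 3 * ((Sx + Sg) / eps + G).
  rewrite /Q /Sx /Sg /G -big_split mulr_suml -big_split mulr_sumr /=.
  apply: ler_sum => i _.
  have := sqr_norm2D3 (grad (f i) x - gs i) (gs i - g i) (g i).
  rewrite subrKA subrK => tri.
  have pV0 : 0 <= (p 0 i)^-1 by rewrite invr_ge0 ltW.
  apply: le_trans (ler_wpM2l pV0 tri) _.
  rewrite mulrCA ler_pM2l // mulrDr lerD2r.
  have -> : norm2 (gs i - g i) = norm2 (g i - gs i).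
    by rewrite -opprB -scaleN1r norm2Z normrN1 mul1r.
  rewrite mulrC; apply: ler_wpM2l; first by rewrite addr_ge0 ?sqr_ge0.
  by rewrite lef_pV2 ?posrE.
have ne : n%:R * eps <= 2^-1.
  rewrite /eps mulrCA divff // mulr1.
  by have := alpha_le; lra.
have G_le := argmin_sampling_obj_le n_gt0 eps_gt0 ne min_p.
have le1 : \sum_i norm2 (g i) <= \sum_i norm2 (gs i) + \sum_i norm2 (g i - gs i).
  rewrite -big_split /=; apply: ler_sum => i _.
  by rewrite -{1}(subrK (gs i) (g i)) addrC norm2_triangle.
have sq : (\sum_i norm2 (g i)) ^+ 2
    <= 2 * (\sum_i norm2 (gs i)) ^+ 2 + 2 * (\sum_i norm2 (g i - gs i)) ^+ 2.
  have A0 : 0 <= \sum_i norm2 (g i) by apply: sumr_ge0 => i _; exact: norm2_ge0.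
  move: le1 A0; set A := \sum_i _; set B := \sum_i _; set C := \sum_i _.
  move=> le1 A0; have := sqr_ge0 (B - C).
  have : A ^+ 2 <= (B + C) ^+ 2 by rewrite ler_pXn2r ?nnegrE // (le_trans A0).
  rewrite sqrrD sqrrB; lra.
have cs := sqr_sum_le (fun i => norm2 (g i - gs i)).
have sE : (\sum_i norm2 (gs i)) ^+ 2 = n%:R ^+ 2 * sigma2 f xs.
  by rewrite /sigma2 mulrA divff ?mul1r // expf_neq0.
apply: le_trans Q_le _; rewrite ler_pM2l // -addrA lerD2l.
by rewrite sE in sq; move: G_le sq cs; rewrite -/G -/Sg; lra.
Qed.

(** The factor [1 / (n p)] makes the step unbiased: [p] cancels in the cross term and survives as
    [1 / p] in the quadratic one. *)
Lemma expected_distance :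
  \sum_i p 0 i * norm2 (x - (alpha * (n%:R * p 0 i)^-1) *: grad (f i) x - xs) ^+ 2
  = D - 2 * alpha * dotp (grad (average f) x) (x - xs) + alpha ^+ 2 / n%:R ^+ 2 * Q.
Proof.
transitivity (\sum_i (p 0 i * D
    - 2 * alpha / n%:R * dotp (grad (f i) x) (x - xs)
    + alpha ^+ 2 / n%:R ^+ 2 * ((p 0 i)^-1 * norm2 (grad (f i) x) ^+ 2))).
  apply: eq_bigr => i _; rewrite addrAC /D !sqr_norm2.
  rewrite !(dotpBl (x - xs)) !(dotpBr (x - xs)) !dotpZl !dotpZr.
  rewrite (dotpC (x - xs) (grad _ _)); field.
  by rewrite nR_neq0 gt_eqF.
rewrite big_split sumrB /= -mulr_suml p_sum mul1r -!mulr_sumr.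
by rewrite dotp_grad_average //; congr (_ - _ + _); field.
Qed.

Lemma lyapunov_step :
  \sum_i \sum_(c : bool) p 0 i * bernoulli_pmf (eps / p 0 i) c
    * V (x - (alpha * (n%:R * p 0 i)^-1) *: grad (f i) x)
        (fun j => if (j == i) && c then grad (f j) x else g j)
  <= (1 - alpha * z) * V x g + 12 * alpha ^+ 2 * sigma2 f xs.
Proof.
pose b : R := 673 / 20000 / L ^+ 2.
have -> : \sum_i \sum_(c : bool) p 0 i * bernoulli_pmf (eps / p 0 i) c
    * V (x - (alpha * (n%:R * p 0 i)^-1) *: grad (f i) x)
        (fun j => if (j == i) && c then grad (f j) x else g j)
  = b * (Sg + eps * (Sx - Sg))
    + \sum_i p 0 i * norm2 (x - (alpha * (n%:R * p 0 i)^-1) *: grad (f i) x - xs) ^+ 2.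
  (* Entry [i] is refreshed with probability [p 0 i * (eps / p 0 i) = eps], the same for all [i];
     this is the purpose of the Bernoulli draw. *)
  transitivity (\sum_i (b * (p 0 i * Sg
      + eps * (norm2 (grad (f i) x - gs i) ^+ 2 - norm2 (g i - gs i) ^+ 2))
      + p 0 i * norm2 (x - (alpha * (n%:R * p 0 i)^-1) *: grad (f i) x - xs) ^+ 2)).
    apply: eq_bigr => i _; rewrite big_bool /= !lyapunovE.
    have -> : \sum_j norm2 ((if (j == i) && true then grad (f j) x else g j) - gs j) ^+ 2
       = Sg + norm2 (grad (f i) x - gs i) ^+ 2 - norm2 (g i - gs i) ^+ 2.
      rewrite -big_update1; apply: eq_bigr => j _.
      by rewrite andbT; case: eqP => [->|_]; reflexivity.
    have -> : \sum_j norm2 ((if (j == i) && false then grad (f j) x else g j) - gs j) ^+ 2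
       = Sg by apply: eq_bigr => j _; rewrite andbF.
    by rewrite -/b; field; rewrite gt_eqF.
  rewrite big_split /=; congr (_ + _).
  by rewrite -mulr_sumr big_split /= -mulr_suml p_sum mul1r -mulr_sumr sumrB.
rewrite expected_distance lyapunovE -/b -/Sg -/D.
have Sx_le : Sx <= 2 * L * n%:R * (average f x - average f xs).
  exact: sum_grad_diff_le.
have := sampling_second_moment.
have := convex_F x xs.
have -> : xs - x = (-1) *: (x - xs) by rewrite scaleN1r opprB.
rewrite dotpZr norm2Z normrN1 mul1r mulN1r -/D.
set Phi := average f x - average f xs in Sx_le *.
set ip := dotp _ _; set s2 := sigma2 _ _ => sc Q_le.
have ip_ge : Phi + mu / 2 * D <= ip by rewrite /Phi; lra.
have Sg0 : 0 <= Sg by apply: sumr_ge0 => i _; exact: sqr_ge0.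
have D0 : 0 <= D by exact: sqr_ge0.
have Phi0 : 0 <= Phi by rewrite subr_ge0; case: min_xs => _; exact.
pose r := alpha / (L * n%:R).
have r0 : 0 < r by rewrite divr_gt0 // mulr_gt0.
have epsb : eps * b = 673 / 1000 * r by rewrite /eps /b /r; field; rewrite nR_neq0.
have Q2 : alpha ^+ 2 / n%:R ^+ 2 * Q
    <= 3 / 20 * r * (Sx + Sg) + 12 * alpha ^+ 2 * s2 + 12 * alpha ^+ 2 / n%:R * Sg.
  have k0 : 0 <= alpha ^+ 2 / n%:R ^+ 2 by rewrite divr_ge0 // sqr_ge0.
  apply: le_trans (ler_wpM2l k0 Q_le) _; rewrite le_eqVlt; apply/orP; left.
  by apply/eqP; rewrite /eps /r; field; rewrite nR_neq0 L_neq0 alpha_neq0.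
have rSx : r * Sx <= 2 * alpha * Phi.
  have := ler_wpM2l (ltW r0) Sx_le.
  rewrite (_ : r * (2 * L * n%:R * Phi) = 2 * alpha * Phi) //.
  by rewrite /r; field; rewrite nR_neq0.
have a2 : 12 * alpha ^+ 2 / n%:R * Sg <= 3 / 10 * (r * Sg).
  rewrite (mulrA (3 / 10)); apply: ler_wpM2r => //.
  have -> : 12 * alpha ^+ 2 / n%:R = 3 / 10 * r * (40 * L * alpha).
    by rewrite /r; field; rewrite nR_neq0.
  by rewrite ler_piMr // mulr_ge0 // ltW.
have zb : alpha * z * (b * Sg) <= 673 / 20000 * (r * Sg).
  rewrite (mulrA (alpha * z)) (mulrA (673 / 20000)); apply: ler_wpM2r => //.
  have -> : 673 / 20000 * r = alpha * (L / n%:R) * b.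
    by rewrite /r /b; field; rewrite nR_neq0 L_neq0.
  apply: ler_wpM2r; first by rewrite /b divr_ge0 ?divr_ge0 ?ler0n ?sqr_ge0.
  by rewrite ler_pM2l.
have zD : alpha * z * D <= alpha * mu * D.
  by apply: ler_wpM2r => //; rewrite ler_pM2l.
have aip := ler_wpM2l (ltW alpha_gt0) ip_ge.
have rSg : 0 <= r * Sg by rewrite mulr_ge0 // ltW.
have aPhi : 0 <= alpha * Phi by rewrite mulr_ge0 // ltW.
have bE : b * (Sg + eps * (Sx - Sg)) = b * Sg + 673 / 1000 * (r * Sx - r * Sg).
  by rewrite mulrDr (mulrA b) (mulrC b eps) epsb -mulrBr; ring.
rewrite bE.
clearbody b r ip Phi s2 Sg Sx D Q eps.
(* Coefficients: [r * Sg] collects [-0.673 + 0.15 + 0.3 + 0.03365 < 0]; [r * Sx] collects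
   [0.673 + 0.15 = 0.823], hence at most [1.646 * alpha * Phi], below the available
   [2 * alpha * Phi]. *)
lra.
Qed.

End OneStep.

(** * Expectations as finite sums over histories of draws *)

Lemma expectation_finite (R : realType) (dsp : measure_display)
    (Omega : measurableType dsp) (P : probability Omega R) (S : finType)
    (h : Omega -> S) (y : S -> R) :
  (forall s, measurable [set w | h w = s]) -> (forall s, 0 <= y s) ->
  'E_P[fun w => y (h w)]%E = (\sum_s y s * fine (P [set w | h w = s]))%:E.
Proof.
move=> mh y0; rewrite unlock.
have ind_h s w : \1_[set w | h w = s] w = (h w == s)%:R :> R.
  by rewrite indicE; congr (_ : bool)%:R; apply/idP/eqP; rewrite inE.
transitivity (\int[P]_w (\sum_s (y s * \1_[set w | h w = s] w)%:E)%E)%E.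
  apply: eq_integral => w _; rewrite sumEFin; congr (_%:E).
  rewrite (bigD1 (h w)) //= ind_h eqxx mulr1 big1 ?addr0 // => s /negPf hs.
  by rewrite ind_h eq_sym hs mulr0.
rewrite ge0_integral_sum //; first last.
- by move=> s w _; rewrite lee_fin ind_h mulr_ge0.
- move=> s; apply/measurable_EFinP; apply: measurable_funM; first exact: measurable_cst.
  by apply: measurable_indic.
rewrite -sumEFin; apply: eq_bigr => s _.
rewrite (integralZl_indic _ (fun=> [set w | h w = s])) //.
  by rewrite integral_indic // setIT EFinM fineK // fin_num_measure.
by rewrite ltNge y0.
Qed.

(** Nested pairs with the latest draw outermost, so that a sum over histories splits off the last
    draw directly. *)
Fixpoint history (T : finType) (k : nat) : finType :=
  if k is k'.+1 then (history T k' * T)%type else unit.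

Lemma sum_historyS (R : realType) (T : finType) (k : nat)
    (F : history T k.+1 -> R) :
  \sum_s F s = \sum_(s : history T k) \sum_(t : T) F (s, t).
Proof. by rewrite pair_bigA; apply: eq_bigr => -[]. Qed.

Section History.
Context {R : realType} {n : nat} {dsp : measure_display}
  {Omega : measurableType dsp}.
Variables (I : nat -> Omega -> 'I_n) (B : nat -> Omega -> bool).

Fixpoint hist (k : nat) (w : Omega) : history ('I_n * bool)%type k :=
  if k is k'.+1 then (hist k' w, (I k' w, B k' w)) else tt.

Lemma same_past_hist k w w' :
  same_past I B k w w' <-> hist k w' = hist k w.
Proof.
elim: k => [|k IHk] /=; first by split.
split=> [same|[/IHk same IE BE] t].
  have -> : hist k w' = hist k w.
    by apply/IHk => t tk; apply: same; rewrite ltnS ltnW.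
  by have [-> ->] := same k (leqnn _).
by rewrite ltnS leq_eqVlt => /predU1P[->|/same].
Qed.

Lemma hist_stepE k w i c :
  [set w' | hist k.+1 w' = (hist k w, (i, c))]
  = same_past I B k w `&` [set w' | I k w' = i] `&` [set w' | B k w' = c].
Proof.
apply/seteqP; split=> w' /=.
  by case=> /same_past_hist ? ? ?.
by case=> -[/same_past_hist -> -> ->].
Qed.

Hypothesis mI : forall k i, measurable [set w | I k w = i].
Hypothesis mB : forall k c, measurable [set w | B k w = c].

Lemma measurable_hist k s : measurable [set w | hist k w = s].
Proof.
elim: k s => [|k IHk] /= s.
  by rewrite (_ : [set _ | _] = setT) //; apply/seteqP; split=> w //= _; case: s.
case: s => s [i c].
rewrite (_ : [set _ | _] = [set w | hist k w = s] `&`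
    ([set w | I k w = i] `&` [set w | B k w = c])).
  by apply: measurableI => //; apply: measurableI.
by apply/seteqP; split=> w /=; [case=> -> -> -> | case=> -> [-> ->]].
Qed.

Variable P : probability Omega R.

Definition hist_mass k (s : history ('I_n * bool)%type k) : R :=
  fine (P [set w | hist k w = s]).

(* The value of X on the atom {hist k = s}, and 0 when this atom is empty. *)
Definition on_hist k (X : Omega -> R) (s : history ('I_n * bool)%type k) : R :=
  if pselect (exists w, hist k w = s) is left ex then X (projT1 (cid ex)) else 0.

(** Plays the role of measurability with respect to the first [k] draws. *)
Definition past_fun k (X : Omega -> R) :=
  forall w w', hist k w = hist k w' -> X w = X w'.

Lemma hist_mass_ge0 k (s : history ('I_n * bool)%type k) : 0 <= hist_mass s.
Proof. exact/fine_ge0/measure_ge0. Qed.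

Lemma on_histE k X w : past_fun k X -> on_hist X (hist k w) = X w.
Proof.
move=> pX; rewrite /on_hist; case: pselect => [ex|[]]; last by exists w.
by case: (cid ex) => w' /= /pX.
Qed.

Lemma on_hist_ge0 k X s : (forall w, 0 <= X w) -> 0 <= @on_hist k X s.
Proof. by move=> X0; rewrite /on_hist; case: pselect. Qed.

Lemma expectation_hist k X : past_fun k X -> (forall w, 0 <= X w) ->
  'E_P[X]%E = (\sum_(s : history ('I_n * bool)%type k) on_hist X s * hist_mass s)%:E.
Proof.
move=> pX X0; rewrite -expectation_finite.
- by congr expectation; apply/funext => w; rewrite on_histE.
- exact: measurable_hist.
- by move=> s; exact: on_hist_ge0.
Qed.

Lemma hist_mass_sum k :
  \sum_(s : history ('I_n * bool)%type k) hist_mass s = 1.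
Proof.
have := @expectation_finite R dsp Omega P _ (hist k) (fun=> 1)
  (@measurable_hist k) (fun=> ler01).
rewrite expectation_cst => -[->].
by apply: eq_bigr => s _; rewrite mul1r.
Qed.

Lemma hist_mass_empty k (s : history ('I_n * bool)%type k) :
  ~ (exists w, hist k w = s) -> hist_mass s = 0.
Proof.
move=> nex; rewrite /hist_mass (_ : [set _ | _] = set0) ?measure0 //.
by apply/seteqP; split=> w //= ws; apply: nex; exists w.
Qed.

Variables (p : nat -> Omega -> 'rV[R]_n) (eps : nat -> R).
Hypothesis eps_le_p : forall k w i, 0 < eps k <= p k w 0 i.
Hypothesis I_law : forall k w i,
  P (same_past I B k w `&` [set w' | I k w' = i])
  = (P (same_past I B k w) * (p k w 0 i)%:E)%E.
Hypothesis B_law : forall k w i c,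
  P (same_past I B k w `&` [set w' | I k w' = i] `&` [set w' | B k w' = c])
  = (P (same_past I B k w `&` [set w' | I k w' = i])
     * (bernoulli_pmf (eps k / p k w 0 i) c)%:E)%E.

(** Product of the two conditional laws: the index given the past, then the bit given the past and
    the index. *)
Lemma hist_mass_step k w i c :
  @hist_mass k.+1 (hist k w, (i, c))
  = hist_mass (hist k w)
    * (p k w 0 i * bernoulli_pmf (eps k / p k w 0 i) c).
Proof.
rewrite /hist_mass hist_stepE B_law I_law.
have -> : same_past I B k w = [set w' | hist k w' = hist k w].
  by apply/seteqP; split=> w' /same_past_hist.
have Pfin : P [set w' | hist k w' = hist k w] \is a fin_num.
  by rewrite fin_num_measure //; exact: measurable_hist.
by rewrite -(fineK Pfin) -!EFinM /= mulrA.
Qed.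

(** Tower property: [Th w i c] is the value of [Y] if the next draw were [(i, c)], so the last
    premise is a conditional bound, to be averaged over the atoms of the past. *)
Lemma expectation_step k (X Y : Omega -> R) (Th : Omega -> 'I_n -> bool -> R)
    (r t : R) :
  past_fun k X -> (forall w, 0 <= X w) ->
  past_fun k.+1 Y -> (forall w, 0 <= Y w) ->
  (forall w, Y w = Th w (I k w) (B k w)) ->
  (forall i c, past_fun k (fun w => Th w i c)) ->
  (forall w i c, 0 <= Th w i c) ->
  (forall w, \sum_i \sum_(c : bool)
     p k w 0 i * bernoulli_pmf (eps k / p k w 0 i) c * Th w i c
     <= r * X w + t) ->
  fine 'E_P[Y]%E <= r * fine 'E_P[X]%E + t.
Proof.
move=> pX X0 pY Y0 YE pTh Th0 step.
rewrite (expectation_hist pX X0) (expectation_hist pY Y0) /=.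
(* Spreading [t] over the total mass [1] allows a comparison atom by atom. *)
rewrite -[X in _ + X](mulr1 t) -(hist_mass_sum k) !mulr_sumr -big_split /=.
rewrite sum_historyS.
apply: ler_sum => s _.
(* An empty atom offers no [w] for the conditional bound, but it and all its extensions have mass
   zero. *)
have [[w ws]|nex] := pselect (exists w, hist k w = s); last first.
  rewrite (hist_mass_empty nex) !mulr0 addr0 big1 // => ic _.
  by rewrite hist_mass_empty ?mulr0 // => -[w [ws _]]; apply: nex; exists w.
rewrite -ws on_histE // mulrA -mulrDl [leRHS]mulrC.
apply: le_trans (ler_wpM2l (hist_mass_ge0 _) (step w)).
rewrite pair_bigA /= mulr_sumr; apply: ler_sum => -[i c] _ /=.
rewrite hist_mass_step mulrC -!mulrA.
have /andP[e0 ep] := eps_le_p k w i.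
have p0 : 0 < p k w 0 i by exact: lt_le_trans ep.
apply: ler_wpM2l; first exact: hist_mass_ge0.
apply: ler_wpM2l; first exact: ltW.
apply: ler_wpM2l.
  by case: c => /=; rewrite ?subr_ge0 ?ler_pdivrMr ?mul1r // divr_ge0 ?ltW.
(* If the extended atom is empty, the default [0] is below [Th] by nonnegativity; otherwise equality
   holds at a representative with the same past. *)
rewrite /on_hist; case: pselect => // ex; case: (cid ex) => w' /= [hw' Ii Bc].
by rewrite YE Ii Bc (pTh _ _ _ _ hw').
Qed.

End History.

(** * The step-size schedule and its weights *)

Section StepSizes.
Context {R : realType} (n : nat) (L mu : R).
Hypotheses (n_gt0 : (0 < n)%N) (L_gt0 : 0 < L) (mu_gt0 : 0 < mu).

Let z := zeta n L mu.
Let q := L / z.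
Let m k : R := k%:R + k_shift n L mu.

(** The [- 1] makes [weight k.+1] equal to the factor [c + m (m + 2)] in the denominator of the step
    size. *)
Definition weight k : R := c_shift n L mu + m k ^+ 2 - 1.

Lemma zeta_le_L : z <= L / n%:R.
Proof. by rewrite /z /zeta ge_min lexx. Qed.

Lemma zeta_le_mu : z <= mu.
Proof. by rewrite /z /zeta ge_min lexx orbT. Qed.

Lemma zeta_gt0 : 0 < z.
Proof. by rewrite /z /zeta lt_min mu_gt0 divr_gt0 // ltr0n. Qed.

Let q_ge1 : 1 <= q.
Proof.
rewrite /q ler_pdivlMr ?zeta_gt0 // mul1r; apply: le_trans zeta_le_L _.
by rewrite ler_pdivrMr ?ltr0n // ler_pMr // ler1n.
Qed.

Let mE k : m k = k%:R + (80 * q - 2).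
Proof. by rewrite /m /k_shift /q mulrA. Qed.

Let cE : c_shift n L mu = 40 * q.
Proof. by rewrite /c_shift /q mulrA. Qed.

Let m_ge k : 80 * q - 2 <= m k /\ k%:R <= m k.
Proof.
by rewrite mE; have := ler0n R k; have := q_ge1; split; lra.
Qed.

Lemma weight_ge_sqr k : k%:R ^+ 2 <= weight k.
Proof.
have [_ mk] := m_ge k; have := q_ge1.
have : k%:R ^+ 2 <= m k ^+ 2 by rewrite ler_pXn2r // nnegrE ?(le_trans _ mk).
by rewrite /weight cE; lra.
Qed.

Lemma weight_gt0 k : 0 < weight k.
Proof.
by have := q_ge1; have := sqr_ge0 (m k); rewrite /weight cE; lra.
Qed.

Let weightS k : weight k.+1 = c_shift n L mu + m k * (m k + 2).
Proof. by rewrite /weight /m -natr1; ring. Qed.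

Lemma step_size_weight k :
  step_size n L mu k = (2 * m k + 1) / (weight k.+1 * z).
Proof. by rewrite weightS. Qed.

Lemma step_size_gt0 k : 0 < step_size n L mu k.
Proof.
rewrite step_size_weight divr_gt0 // ?mulr_gt0 ?zeta_gt0 ?weight_gt0 //.
by have := q_ge1; have [] := m_ge k; lra.
Qed.

(** After clearing denominators [c_shift = 40 * q] absorbs the [+ 1] of the numerator, and what
    remains is [80 * q <= m k + 2], which is what [k_shift] ensures. *)
Lemma step_size_le k : 40 * L * step_size n L mu k <= 1.
Proof.
rewrite step_size_weight mulrA ler_pdivrMr ?mulr_gt0 ?zeta_gt0 ?weight_gt0 //.
have z0 := zeta_gt0.
have -> : L = q * z by rewrite /q mulfVK // gt_eqF.
rewrite mul1r weightS cE.
have -> : 40 * (q * z) * (2 * m k + 1) = 40 * q * (2 * m k + 1) * z by ring.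
rewrite ler_pM2r //; have := q_ge1; have [] := m_ge k; nra.
Qed.

(** The numerator [2 * m k + 1] of the step size is exactly the increment of the weight. *)
Lemma weight_contraction k :
  weight k.+1 * (1 - step_size n L mu k * z) = weight k.
Proof.
have W0 := weight_gt0 k.+1; have z0 := zeta_gt0.
have -> : weight k = weight k.+1 - (2 * m k + 1).
  by rewrite weightS /weight; ring.
by rewrite step_size_weight; field; rewrite !gt_eqF.
Qed.

Lemma weight_step_size_sqr k :
  weight k.+1 * step_size n L mu k ^+ 2 <= 4 / z ^+ 2.
Proof.
have W0 := weight_gt0 k.+1; have z0 := zeta_gt0.
rewrite step_size_weight.
have -> : weight k.+1 * ((2 * m k + 1) / (weight k.+1 * z)) ^+ 2
    = (2 * m k + 1) ^+ 2 / weight k.+1 / z ^+ 2.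
  by field; rewrite !gt_eqF.
apply: ler_wpM2r; first by rewrite invr_ge0 sqr_ge0.
rewrite ler_pdivrMr // weightS cE.
by have := q_ge1; have [] := m_ge k; nra.
Qed.

(** Multiplied by [weight k.+1], the recursion telescopes, each step adding at most
    [12 * (4 / z ^+ 2) * s]. *)
Lemma weighted_recursion (e : nat -> R) (s : R) : 0 <= s ->
  (forall k, e k.+1 <= (1 - step_size n L mu k * z) * e k
     + 12 * step_size n L mu k ^+ 2 * s) ->
  forall k, weight k * e k <= weight 0 * e 0%N + 48 / z ^+ 2 * s * k%:R.
Proof.
move=> s0 step; elim=> [|k IHk]; first by rewrite mulr0 addr0.
apply: le_trans (ler_wpM2l (ltW (weight_gt0 _)) (step k)) _.
rewrite mulrDr mulrA weight_contraction -natr1.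
have := ler_wpM2r s0 (weight_step_size_sqr k).
move: IHk; lra.
Qed.

End StepSizes.

(** * Application to runs of the algorithm, and the final rate *)

(** Iterate and table follow by induction through the update rules; for [p], whose minimiser may not
    be unique, this is the tie-breaking condition of the run. *)
Lemma SRG_run_past (R : realType) (n d : nat) (dsp : measure_display)
    (Omega : measurableType dsp) (alpha eps : nat -> R)
    (f : 'I_n -> 'rV[R]_d -> R) (x0 : 'rV[R]_d) (g0 : 'I_n -> 'rV[R]_d)
    (P : probability Omega R)
    (x : nat -> Omega -> 'rV[R]_d) (g : nat -> Omega -> 'I_n -> 'rV[R]_d)
    (p : nat -> Omega -> 'rV[R]_n) (I : nat -> Omega -> 'I_n)
    (B : nat -> Omega -> bool) :
  SRG_run alpha eps f x0 g0 P x g p I B ->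
  forall k w w', hist I B k w = hist I B k w' ->
    [/\ x k w = x k w', g k w = g k w' & p k w = p k w'].
Proof.
move=> run.
have pE k w w' : hist I B k w = hist I B k w' -> p k w = p k w'.
  by move=> /same_past_hist /(SRG_p_past run).
elim=> [|k IHk] w w' hE; split; try exact: pE.
- by rewrite !(SRG_x0 run).
- by apply/funext => i; rewrite !(SRG_g0 run).
- case: hE => /IHk[xE gE pkE] IE BE.
  by rewrite !(SRG_x_step run) xE pkE IE.
- case: hE => /IHk[xE gE pkE] IE BE; apply/funext => i.
  by rewrite !(SRG_g_step run) xE gE IE BE.
Qed.

Lemma lyapunov_ge0 (R : realType) (n d : nat) (L alpha eps : R)
    (f : 'I_n -> 'rV[R]_d -> R) (xs x : 'rV[R]_d) (g : 'I_n -> 'rV[R]_d) :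
  0 <= L -> 0 <= alpha -> 0 <= eps -> 0 <= lyapunov L alpha eps f xs x g.
Proof.
move=> L0 a0 e0; apply: addr_ge0; last exact: sqr_ge0.
apply: mulr_ge0; last by apply: sumr_ge0 => i _; exact: sqr_ge0.
have ne0 : 0 <= n%:R * eps by rewrite mulr_ge0 ?ler0n.
by apply: mulr_ge0; do ?[exact: ler0n | exact: L0 | apply: divr_ge0].
Qed.

Unset Implicit Arguments.

Theorem corollary2 (R : realType) (n d : nat) (L mu : R)
    (n_gt0 : (0 < n)%N) (L_gt0 : 0 < L) (mu_gt0 : 0 < mu) :
  exists (C1 C2 : R) (K : nat), 0 < C1 /\ 0 < C2 /\
  forall (f : 'I_n -> 'rV[R]_d -> R) (xs : 'rV[R]_d),
    (forall x, differentiable (average f) x) ->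
    strongly_convex mu (average f) ->
    (forall i x, differentiable (f i) x) ->
    (forall i, convex_function (setT : set (convex_lmodType 'rV[R]_d)) (f i)) ->
    (forall i, smooth L (f i)) ->
    is_argmin setT (average f) xs ->
  forall (x0 : 'rV[R]_d) (g0 : 'I_n -> 'rV[R]_d)
    (dsp : measure_display) (Omega : measurableType dsp)
    (P : probability Omega R)
    (x : nat -> Omega -> 'rV[R]_d) (g : nat -> Omega -> 'I_n -> 'rV[R]_d)
    (p : nat -> Omega -> 'rV[R]_n)
    (I : nat -> Omega -> 'I_n) (B : nat -> Omega -> bool),
    let alpha := step_size n L mu in
    let eps := lower_bound n L mu in
    let T k x g := lyapunov L (alpha k) (eps k) f xs x g in
    SRG_run alpha eps f x0 g0 P x g p I B ->
  forall k : nat, (K <= k)%N ->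
    ('E_P[fun w => T k (x k w) (g k w)] <=
      (C1 * ((T 0%N x0 g0 + sigma2 f xs * ln k%:R) / k%:R ^+ 2)
       + C2 * (sigma2 f xs / k%:R))%:E)%E.
Proof.
have z0 := zeta_gt0 n_gt0 L_gt0 mu_gt0.
(* The initial weight multiplies [T 0], and the noise per step gives the [1 / k] term. Starting at
   [k = 1] makes [k] invertible and [ln k] nonnegative. *)
exists (weight n L mu 0), (48 / zeta n L mu ^+ 2), 1%N.
split; first exact: weight_gt0.
split; first by rewrite divr_gt0 // exprn_gt0.
move=> f xs _ convex_F df convex_f smooth_f min_xs x0 g0 dsp Omega P x g p I B.
move=> alpha eps T run k k_ge1.
have a0 j : 0 < alpha j by exact: step_size_gt0.
have e0 j : 0 < eps j.
  apply: divr_gt0; last by rewrite ltr0n.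
  by apply: mulr_gt0 (a0 j); rewrite mulr_gt0.
have T0 j y h : 0 <= T j y h by apply: lyapunov_ge0; exact: ltW.
have TE i j y h : T i y h = T j y h.
  by rewrite /T /eps /lower_bound !lyapunovE.
pose X j w := T j (x j w) (g j w).
have pX j : past_fun I B j (X j).
  by move=> w w' /(SRG_run_past run)[xE gE _]; rewrite /X xE gE.
have X0 j w : 0 <= X j w by exact: T0.
have ep j w i : 0 < eps j <= p j w 0 i.
  by rewrite e0; case: (SRG_p_argmin run j w) => -[_ ->].
have s0 : 0 <= sigma2 f xs by rewrite mulr_ge0 ?invr_ge0 ?sqr_ge0.
have step j : fine 'E_P[X j.+1]%E
    <= (1 - alpha j * zeta n L mu) * fine 'E_P[X j]%E
       + 12 * alpha j ^+ 2 * sigma2 f xs.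
  apply: (expectation_step (SRG_measurable_I run) (SRG_measurable_B run) ep
    (SRG_I_law run) (SRG_B_law run) (pX j) (X0 j) (pX j.+1) (X0 j.+1) (Th := fun w i c =>
      T j (x j w - (alpha j * (n%:R * p j w 0 i)^-1) *: grad (f i) (x j w))
        (fun l => if (l == i) && c then grad (f l) (x j w) else g j w l))).
  - move=> w; rewrite /X (TE _ j) (SRG_x_step run); congr (T j _ _).
    by apply/funext => i; rewrite (SRG_g_step run).
  - move=> i c w w' /(SRG_run_past run)[xE gE pE].
    by rewrite xE gE pE.
  - by move=> w i c; exact: T0.
  - move=> w; exact: (lyapunov_step n_gt0 L_gt0 (zeta_le_L n L mu)
      (zeta_le_mu n L mu) (a0 j) (step_size_le n_gt0 L_gt0 mu_gt0 j) df smooth_f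
      convex_f convex_F min_xs (x j w) (SRG_p_argmin run j w)).
have X00 : 'E_P[X 0%N]%E = (T 0%N x0 g0)%:E.
  rewrite -(expectation_cst P); congr expectation; apply/funext => w.
  rewrite /X (SRG_x0 run); congr (T _ _ _); apply/funext => i.
  by rewrite (SRG_g0 run).
(* The expectation is a finite sum of reals, so the real-valued recursion transfers back to the
   extended reals. *)
have Efin : 'E_P[X k]%E = (fine 'E_P[X k]%E)%:E.
  by rewrite (expectation_hist (SRG_measurable_I run) (SRG_measurable_B run) P
    (pX k) (X0 k)).
have := weighted_recursion n_gt0 L_gt0 mu_gt0 s0 step k.
rewrite /= X00 /= => rec.
rewrite -/(X k) Efin lee_fin.
have k0 : 0 < k%:R :> R by rewrite ltr0n.
have Ek0 : 0 <= fine 'E_P[X k]%E.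
  by rewrite -lee_fin -Efin unlock; apply: integral_ge0 => w _; rewrite lee_fin.
have : k%:R ^+ 2 * fine 'E_P[X k]%E
    <= weight n L mu 0 * T 0%N x0 g0 + 48 / zeta n L mu ^+ 2 * sigma2 f xs * k%:R.
  by apply: le_trans rec; apply: ler_wpM2r => //; exact: weight_ge_sqr.
rewrite mulrC -ler_pdivlMr ?exprn_gt0 // => /le_trans; apply.
rewrite mulrDl; apply: lerD; last first.
  by rewrite le_eqVlt; apply/orP; left; apply/eqP; field; rewrite !gt_eqF.
rewrite -mulrA; apply: ler_wpM2l; first exact/ltW/weight_gt0.
apply: ler_wpM2r; first by rewrite invr_ge0 sqr_ge0.
(* The logarithmic term is nonnegative and only enlarges the right side. *)
by rewrite lerDl mulr_ge0 // ln_ge0 // ler1n.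
Qed.
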